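(* Let $(\mathcal{X},\mathcal{Y},\ell,S)$ be a Blackwell instance with $\mathcal{X}\subset\mathbb{R}^n_+$, $\mathcal{Y}\subset\mathbb{R}^m_+$, $S\subset\mathbb{R}^d$ compact and approachable, and $\ell\ge0$ coordinate-wise on $\mathbb{R}^n_+\times\mathbb{R}^m_+$. Let $\mathcal{O}_{\mathcal{Y}}$ be an approximation oracle for $\mathcal{Y}$ with ratio $0<\alpha_{\mathcal{Y}}\le1$. Put $\tilde R=\|\ell\|R_{\mathcal{X}}R_{\mathcal{Y}}$, $\tilde S=\frac{1}{\alpha_{\mathcal{Y}}}(S-\mathcal{B}_+(\tilde R))$, $$G_{\mathcal{X}}=(\alpha_{\mathcal{Y}}+2)\|\ell\|R_{\mathcal{Y}},\qquad G_3=\max_{s\in S,\ u\in\mathcal{B}_+(\tilde R),\ x\in\mathcal{X},\ y\in\mathcal{Y}}\Big\|\frac{1}{\alpha_{\mathcal{Y}}}(s-u)-\ell(x,y)\Big\|.$$ Fix $T\ge1$, and let $N=\lceil G_{\mathcal{X}}^2D_{\mathcal{X}}^2T/\alpha_{\mathcal{Y}}^2\rceil$, $\eta=\frac{2}{G_3\sqrt T}$, $\mu=\frac{D_{\mathcal{X}}}{G_{\mathcal{X}}\sqrt N}$. Consider the following algorithm. Start with an arbitrary $w_1\in\mathcal{B}(1)\subset\mathbb{R}^d$. For $t=1,\dots,T$: (1) Let $A_t=\sum_{i=1}^dw_t(i)L_i$. Choose an arbitrary $u_1\in\mathcal{X}$, and for $i=1,\dots,N$ set $(p_i,q_i)=\widehat{\mathcal{O}_{\mathcal{Y}}}(-A_t^\top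 u_i)$ and $u_{i+1}=\Pi_{\mathcal{X}}(u_i-\mu A_tp_i)$. Set $x_t=s_t=\frac1N\sum_{i=1}^Nu_i$. (2) Play $s_t\in\mathcal{X}$ and observe $y_t\in\mathcal{Y}$ chosen arbitrarily by the adversary. (3) Set $f_t(w)=h_{\tilde S}(w)-\langle w,\ell(x_t,y_t)\rangle$ and $w_{t+1}=\Pi_{\mathcal{B}(1)}(w_t-\eta\,\partial f_t(w_t))$, where $\partial f_t(w_t)$ is any subgradient of $f_t$ at $w_t$. Then, for every choice of $y_1,\dots,y_T\in\mathcal{Y}$ by the adversary, the average loss $\bar\ell_{s,T}=\frac1T\sum_{t=1}^T\ell(s_t,y_t)$ satisfies $$d\big(\bar\ell_{s,T},(\alpha_{\mathcal{Y}}^{-1}S)_{\downarrow}\big)\le\frac{6G_3+3}{2\sqrt T},$$ and the overall number of calls to $\mathcal{O}_{\mathcal{Y}}$ is $O\big(G_{\mathcal{X}}^2D_{\mathcal{X}}^2T^2/\alpha_{\mathcal{Y}}^2\big)$.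
   Context: **Blackwell instance.** A tuple $(\mathcal{X},\mathcal{Y},\ell,S)$ where $\mathcal{X}\subset\mathbb{R}^n$ and $\mathcal{Y}\subset\mathbb{R}^m$ are nonempty, convex and compact, $S\subset\mathbb{R}^d$ is nonempty, convex and closed, and $\ell:\mathbb{R}^n\times\mathbb{R}^m\to\mathbb{R}^d$ is bilinear. $S$ is approachable if there is an algorithm selecting $x_t\in\mathcal{X}$ as a function of $y_1,\dots,y_{t-1}$ such that for every sequence $(y_t)_{t\ge1}\subseteq\mathcal{Y}$, $d(\frac1T\sum_{t=1}^T\ell(x_t,y_t),S)\to0$ as $T\to\infty$. **Notation.** $\|\cdot\|$ is the Euclidean norm for vectors and the spectral norm for matrices; $d(\cdot,\cdot)$ is Euclidean distance from a point to a set; $\mathcal{B}(R)$ is the closed origin-centered Euclidean ball of radius $R$ and $\mathcal{B}_+(R)$ its intersection with the nonnegative orthant; $S-\mathcal{B}_+(R)=\{s-b:s\in S,b\in\mathcal{B}_+(R)\}$; $\Pi_K$ is Euclidean projection onto $K$; $h_K(w)=\sup_{k\in K}\langle w,k\rangle$; $(K)_{\downarrow}=\{y:\exists x\in K,\ y\le x\}$ (coordinate-wise). $R_{\mathcal{X}}\ge\max_{x\in\mathcal{X}}\|x\|$, $R_{\mathcal{Y}}\ge\max_{y\in\mathcal{Y}}\|y\|$ and $D_{\mathcal{X}}\ge\max_{x,x'\in\mathcal{X}}\|x-x'\|$ are fixed upper bounds. $L_1,\dots,L_d\in\mathbb{R}^{n\times m}$ are the matrices with $[\ell(x,y)]_i=x^\top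 L_iy$ for all $x,y$, and $\|\ell\|:=\max_{u\in\mathcal{B}(1)}\|\sum_{i=1}^du(i)L_i\|$. The constants $G_{\mathcal{X}},D_{\mathcal{X}},G_3$ are assumed positive so that the step-sizes are well-defined. **Approximation oracle.** A map $\mathcal{O}_{\mathcal{Y}}$ with $\mathcal{O}_{\mathcal{Y}}(c)\in\mathcal{Y}$ and $\langle\mathcal{O}_{\mathcal{Y}}(c),c\rangle\ge\alpha_{\mathcal{Y}}\max_{y\in\mathcal{Y}}\langle y,c\rangle$ for every $c\in\mathbb{R}^m_+$. **Extended approximation oracle.** For $c\in\mathbb{R}^m$ write $c=c^++c^-$ where $c^+$ agrees with $c$ on its nonnegative coordinates and is zero elsewhere, and $c^-$ agrees with $c$ on its negative coordinates and is zero elsewhere. For a vector $q$ let $\vec q=q/\|q\|$ if $q\ne0$ and $\vec q=0$ if $q=0$. Then $$\widehat{\mathcal{O}_{\mathcal{Y}}}(c)=(v,s):=\big(\mathcal{O}_{\mathcal{Y}}(-c^-)-R_{\mathcal{Y}}\,\vec c^{\,+},\ \mathcal{O}_{\mathcal{Y}}(-c^-)\big),$$ where $\vec c^{\,+}$ is the normalization of $c^+$. **Number of calls.** The $O(\cdot)$ hides an absolute constant and is meant for $G_{\mathcal{X}}^2D_{\mathcal{X}}^2T/\alpha_{\mathcal{Y}}^2\ge1$. *)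

(* Defs.v *)
From HB Require Import structures.
From mathcomp Require Import all_boot all_order all_algebra.
From mathcomp Require Import all_classical all_reals all_analysis.

Set Implicit Arguments.
Unset Strict Implicit.
Unset Printing Implicit Defensive.

Import Order.TTheory GRing.Theory Num.Theory.
Import numFieldNormedType.Exports.

Local Open Scope classical_set_scope.
Local Open Scope ring_scope.

(** * Euclidean geometry of column vectors

    The library norm on matrices is the max norm, so the Euclidean norm is
    introduced here.  The library topology on ['cV[R]_k] is the usual one, so
    [closed] and [compact] can be used unchanged. *)

Definition dot {R : realType} {k : nat} (u v : 'cV[R]_k) : R :=
  \sum_(i < k) u i 0 * v i 0.

Definition enorm {R : realType} {k : nat} (u : 'cV[R]_k) : R :=
  Num.sqrt (dot u u).

Definition vle {R : realType} {k : nat} (u v : 'cV[R]_k) : Prop :=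
  forall i, u i 0 <= v i 0.

Definition eball {R : realType} {k : nat} (r : R) : set 'cV[R]_k :=
  [set u | enorm u <= r].

Definition eball_nneg {R : realType} {k : nat} (r : R) : set 'cV[R]_k :=
  [set u | enorm u <= r /\ vle 0 u].

Definition set_dist {R : realType} {k : nat} (u : 'cV[R]_k) (K : set 'cV[R]_k) : R :=
  inf [set enorm (u - v) | v in K].

(** Only meaningful when the nearest point exists, e.g. for [K] nonempty, closed
    and convex, in which case it is unique; the default [0] is then never used. *)
Definition eproj {R : realType} {k : nat} (K : set 'cV[R]_k) (u : 'cV[R]_k) :
    'cV[R]_k :=
  xget 0 [set p | K p /\ forall q, K q -> enorm (u - p) <= enorm (u - q)].

(** Real-valued, hence only meaningful for [K] nonempty and bounded. *)
Definition support_fun {R : realType} {k : nat} (K : set 'cV[R]_k)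
    (w : 'cV[R]_k) : R :=
  sup [set dot w v | v in K].

Definition down_closure {R : realType} {k : nat} (K : set 'cV[R]_k) :
    set 'cV[R]_k :=
  [set y | exists2 x, K x & vle y x].

Definition is_subgradient {R : realType} {k : nat} (f : 'cV[R]_k -> R)
    (w g : 'cV[R]_k) : Prop :=
  forall v, f w + dot g (v - w) <= f v.

Definition spectral_norm {R : realType} {n m : nat} (A : 'M[R]_(n, m)) : R :=
  sup [set enorm (A *m v) | v in eball 1].

(** * Blackwell instances *)

Record blackwell_instance {R : realType} {n m d : nat} (X : set 'cV[R]_n)
    (Y : set 'cV[R]_m) (ell : {bilinear 'cV[R]_n -> 'cV[R]_m -> 'cV[R]_d})
    (S : set 'cV[R]_d) : Prop := {
  instX_neq0 : X !=set0;
  instX_convex : convex_set X;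
  instX_compact : compact X;
  instY_neq0 : Y !=set0;
  instY_convex : convex_set Y;
  instY_compact : compact Y;
  instS_neq0 : S !=set0;
  instS_convex : convex_set S;
  instS_closed : closed S }.

(** The sequence [y] is indexed from [0]; the strategy maps the list of the past
    moves of the adversary to the next move of the player. *)
Definition approachable {R : realType} {n m d : nat} (X : set 'cV[R]_n)
    (Y : set 'cV[R]_m) (ell : 'cV[R]_n -> 'cV[R]_m -> 'cV[R]_d)
    (S : set 'cV[R]_d) : Prop :=
  exists strategy : seq 'cV[R]_m -> 'cV[R]_n,
  forall y : nat -> 'cV[R]_m, (forall t, Y (y t)) ->
  let x t := strategy (mkseq y t) in
  (forall t, X (x t)) /\
  (fun T : nat => set_dist (T%:R^-1 *: \sum_(t < T) ell (x t) (y t)) S)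
    @ \oo --> (0 : R).

Definition is_coord_mx {R : realType} {n m d : nat}
    (ell : 'cV[R]_n -> 'cV[R]_m -> 'cV[R]_d) (L : 'I_d -> 'M[R]_(n, m)) : Prop :=
  forall x y i, ell x y i 0 = (x^T *m L i *m y) 0 0.

Definition lincomb_mx {R : realType} {n m d : nat} (L : 'I_d -> 'M[R]_(n, m))
    (w : 'cV[R]_d) : 'M[R]_(n, m) :=
  \sum_(i < d) w i 0 *: L i.

Definition bilinear_norm {R : realType} {n m d : nat} (L : 'I_d -> 'M[R]_(n, m)) : R :=
  sup [set spectral_norm (lincomb_mx L u) | u in eball 1].

(** * Oracles *)

Definition is_approx_oracle {R : realType} {m : nat} (Y : set 'cV[R]_m) (alpha : R)
    (O : 'cV[R]_m -> 'cV[R]_m) : Prop :=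
  forall c, vle 0 c ->
    Y (O c) /\ alpha * sup [set dot y c | y in Y] <= dot (O c) c.

(** Computations of type [B] which may query an oracle ([Q] is the type of the
    queries, [A] the type of the answers).  The oracle is accessible only through
    [qask], so the counter of [qrun] is the number of calls. *)
Inductive qcomp (Q A B : Type) : Type :=
| qret of B
| qask of Q & (A -> qcomp Q A B).

Arguments qret {Q A B}.
Arguments qask {Q A B}.

Fixpoint qbind {Q A B C : Type} (p : qcomp Q A B) (f : B -> qcomp Q A C) :
    qcomp Q A C :=
  match p with
  | qret b => f b
  | qask q k => qask q (fun a => qbind (k a) f)
  end.

Fixpoint qrun {Q A B : Type} (O : Q -> A) (p : qcomp Q A B) : B * nat :=
  match p with
  | qret b => (b, 0%N)
  | qask q k => let r := qrun O (k (O q)) in (r.1, r.2.+1)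
  end.

Definition pos_part {R : realType} {m : nat} (c : 'cV[R]_m) : 'cV[R]_m :=
  \col_i (if 0 <= c i 0 then c i 0 else 0).

Definition neg_part {R : realType} {m : nat} (c : 'cV[R]_m) : 'cV[R]_m :=
  \col_i (if c i 0 < 0 then c i 0 else 0).

Definition unit_vec {R : realType} {m : nat} (q : 'cV[R]_m) : 'cV[R]_m :=
  if q == 0 then 0 else (enorm q)^-1 *: q.

Definition ext_oracle {R : realType} {m : nat} (RY : R) (c : 'cV[R]_m) :
    qcomp 'cV[R]_m 'cV[R]_m ('cV[R]_m * 'cV[R]_m) :=
  qask (- neg_part c) (fun z => qret (z - RY *: unit_vec (pos_part c), z)).

(** * The algorithm *)

(** Returns the list [u_1; ...; u_N] of the iterates started at [u_1 = u]. *)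
Fixpoint inner_loop {R : realType} {n m : nat} (X : set 'cV[R]_n) (RY mu : R)
    (A : 'M[R]_(n, m)) (N : nat) (u : 'cV[R]_n) :
    qcomp 'cV[R]_m 'cV[R]_m (seq 'cV[R]_n) :=
  if N is N'.+1 then
    qbind (ext_oracle RY (- (A^T *m u))) (fun pq =>
    qbind (inner_loop X RY mu A N' (eproj X (u - mu *: (A *m pq.1)))) (fun us =>
    qret (u :: us)))
  else qret [::].

Definition inner_average {R : realType} {n m : nat} (X : set 'cV[R]_n) (RY mu : R)
    (A : 'M[R]_(n, m)) (N : nat) (u : 'cV[R]_n) :
    qcomp 'cV[R]_m 'cV[R]_m 'cV[R]_n :=
  qbind (inner_loop X RY mu A N u) (fun us => qret (N%:R^-1 *: \sum_(v <- us) v)).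

Definition R_tilde {R : realType} {n m d : nat} (L : 'I_d -> 'M[R]_(n, m))
    (RX RY : R) : R :=
  bilinear_norm L * RX * RY.

Definition S_tilde {R : realType} {d : nat} (S : set 'cV[R]_d) (alpha r : R) :
    set 'cV[R]_d :=
  [set alpha^-1 *: (s - b) | s in S & b in eball_nneg r].

Definition G_X {R : realType} {n m d : nat} (L : 'I_d -> 'M[R]_(n, m))
    (alpha RY : R) : R :=
  (alpha + 2) * bilinear_norm L * RY.

(** The set is the continuous image of a compact set whenever [X], [Y] and [S] are
    compact, so that the supremum is a maximum. *)
Definition G_3 {R : realType} {n m d : nat} (X : set 'cV[R]_n) (Y : set 'cV[R]_m)
    (ell : 'cV[R]_n -> 'cV[R]_m -> 'cV[R]_d) (S : set 'cV[R]_d) (alpha r : R) : R :=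
  sup [set z : R | exists s u x y,
         [/\ S s, eball_nneg r u, X x, Y y &
             z = enorm (alpha^-1 *: (s - u) - ell x y)]].

Definition num_inner {R : realType} (alpha GX DX : R) (T : nat) : nat :=
  `|Num.ceil (GX ^+ 2 * DX ^+ 2 * T%:R / alpha ^+ 2)|%N.

Definition step_outer {R : realType} (G3 : R) (T : nat) : R :=
  2 / (G3 * Num.sqrt T%:R).

Definition step_inner {R : realType} (GX DX : R) (N : nat) : R :=
  DX / (GX * Num.sqrt N%:R).

Definition outer_obj {R : realType} {d : nat} (K : set 'cV[R]_d) (loss w : 'cV[R]_d) : R :=
  support_fun K w - dot w loss.

(** An execution over the rounds [1, ..., T].  The free choices (initial points
    [w 1] and [u1 t], moves [y t] of the adversary, subgradients [g t]) are
    constrained only by membership, so they may depend on the whole past of the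
    execution.  [s t] is the move of the player and [calls t] the number of oracle
    calls of round [t]. *)
Record execution {R : realType} {n m d : nat} (X : set 'cV[R]_n) (Y : set 'cV[R]_m)
    (ell : 'cV[R]_n -> 'cV[R]_m -> 'cV[R]_d) (L : 'I_d -> 'M[R]_(n, m))
    (O : 'cV[R]_m -> 'cV[R]_m) (K : set 'cV[R]_d) (RY eta mu : R) (N T : nat)
    (w : nat -> 'cV[R]_d) (u1 s : nat -> 'cV[R]_n) (y : nat -> 'cV[R]_m)
    (g : nat -> 'cV[R]_d) (calls : nat -> nat) : Prop := {
  exec_init : eball 1 (w 1%N);
  exec_u1 : forall t, (1 <= t <= T)%N -> X (u1 t);
  exec_play : forall t, (1 <= t <= T)%N ->
    (s t, calls t) = qrun O (inner_average X RY mu (lincomb_mx L (w t)) N (u1 t));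
  exec_adversary : forall t, (1 <= t <= T)%N -> Y (y t);
  exec_subgradient : forall t, (1 <= t <= T)%N ->
    is_subgradient (outer_obj K (ell (s t) (y t))) (w t) (g t);
  exec_update : forall t, (1 <= t <= T)%N ->
    w t.+1 = eproj (eball 1) (w t - eta *: g t) }.

(* Main.v *)
Require Import Defs.
From HB Require Import structures.
From mathcomp Require Import all_boot all_order all_algebra.
From mathcomp Require Import all_classical all_reals all_analysis.
From mathcomp Require Import ring lra.

(** The algorithm runs projected gradient descent at two levels.

    Outer level.  The objectives of the rounds are
    [f_t(w) = h(w) - <w, l(s_t, y_t)>], with [h] the support function of the
    relaxed target [S~ = (S - B_+) / alpha].  By duality ([support_distance])
    the distance from the average loss to [S~] is the largest value of
    [<w, average> - h(w)] over the unit ball, that is, of minus the average of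
    the [f_t(w)].  The regret bound ([ogd_regret]) makes this at most
    [2 G3 / sqrt T] minus the average of the [f_t(w_t)], because the
    subgradients have norm at most [G3] ([subgradient_bound]).  So it suffices
    that the move [s_t] makes [f_t(w_t)] at least [- 1 / sqrt T] whatever the
    adversary answers ([play_guarantee]).  Finally every point of [S~] lies
    below a point of [S / alpha] ([S_tilde_down]).

    Inner level.  The move [s_t] has to be a near-optimal strategy of the
    zero-sum game with payoff [u^T A_t y].  The extended oracle returns a
    vector [p] that may lie outside [Y] but satisfies
    [u^T A_t p >= alpha u^T A_t y] for all [y] in [Y] ([ext_answer_le]).
    Descending along [A_t p] therefore gives an average iterate whose payoff
    against any [y], times [alpha], is at most [x^T A_t pbar] plus the regret,
    for every [x] in [X], where [pbar] is the average answer.  Now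
    [pbar = q - RY e] with [q] in [Y] and [e] in the nonnegative unit ball.
    Approachability supplies an [x] with [l(x, q)] in [S]
    ([approachable_response]), and [l(x, RY e)] lies in [B_+] since the loss is
    nonnegative; hence [l(x, pbar)] lies in [alpha S~] and
    [x^T A_t pbar <= alpha h(w_t)] ([response_support]).  The number [N] of
    iterations is chosen so that the regret is at most [alpha / sqrt T].

    Every inner iteration queries the oracle once, so a play costs [T N] calls,
    and rounding [N] up at most doubles the count. *)

Set Implicit Arguments.
Unset Strict Implicit.
Unset Printing Implicit Defensive.

Import Order.TTheory GRing.Theory Num.Theory.
Import numFieldNormedType.Exports.

Local Open Scope classical_set_scope.
Local Open Scope ring_scope.

(** * Euclidean geometry of column vectors *)

Section EuclideanGeometry.
Context {R : realType} {k : nat}.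
Implicit Types (u v w : 'cV[R]_k) (a r : R) (K : set 'cV[R]_k).

Lemma dotC u v : dot u v = dot v u.
Proof. by apply: eq_bigr => i _; rewrite mulrC. Qed.

Lemma dotDl u v w : dot (u + v) w = dot u w + dot v w.
Proof. by rewrite -big_split; apply: eq_bigr => i _; rewrite mxE mulrDl. Qed.

Lemma dotZl a u v : dot (a *: u) v = a * dot u v.
Proof. by rewrite mulr_sumr; apply: eq_bigr => i _; rewrite mxE mulrA. Qed.

Lemma dotNl u v : dot (- u) v = - dot u v.
Proof. by rewrite -scaleN1r dotZl mulN1r. Qed.

Lemma dotDr u v w : dot u (v + w) = dot u v + dot u w.
Proof. by rewrite dotC dotDl !(dotC _ u). Qed.

Lemma dotZr a u v : dot u (a *: v) = a * dot u v.
Proof. by rewrite dotC dotZl dotC. Qed.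

Lemma dotNr u v : dot u (- v) = - dot u v.
Proof. by rewrite dotC dotNl dotC. Qed.

Lemma dot0r u : dot u 0 = 0.
Proof. by rewrite -(scale0r 0) dotZr mul0r. Qed.

Definition dotE := (dotDl, dotDr, dotZl, dotZr, dotNl, dotNr).

Lemma dot_sumr I (s : seq I) (F : I -> 'cV[R]_k) u :
  dot u (\sum_(i <- s) F i) = \sum_(i <- s) dot u (F i).
Proof. by apply: (big_morph (dot u)); [exact: dotDr|exact: dot0r]. Qed.

Lemma dotvv_ge0 u : 0 <= dot u u.
Proof. by apply: sumr_ge0 => i _; rewrite -expr2 sqr_ge0. Qed.

Lemma dotvv_eq0 u : dot u u = 0 -> u = 0.
Proof.
move=> u0; apply/matrixP => i j; rewrite ord1 mxE.
have /psumr_eq0P/(_ i isT)/eqP : dot u u = 0 by [].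
by rewrite mulf_eq0 orbb => /(_ _)/eqP; apply => ? _; rewrite -expr2 sqr_ge0.
Qed.

Lemma dot_vle u v w : vle 0 w -> vle u v -> dot u w <= dot v w.
Proof.
move=> w0 uv; apply: ler_sum => i _; apply: ler_wpM2r => //.
by have := w0 i; rewrite mxE.
Qed.

Lemma enorm_ge0 u : 0 <= enorm u. Proof. exact: sqrtr_ge0. Qed.

Lemma enorm_sqr u : enorm u ^+ 2 = dot u u.
Proof. by rewrite sqr_sqrtr// dotvv_ge0. Qed.

Lemma enorm_le u r : 0 <= r -> (enorm u <= r) = (dot u u <= r ^+ 2).
Proof. by move=> r0; rewrite -enorm_sqr ler_sqr ?nnegrE ?enorm_ge0. Qed.

Lemma enorm_eq0 u : enorm u = 0 -> u = 0.
Proof. by move=> u0; apply: dotvv_eq0; rewrite -enorm_sqr u0 expr0n. Qed.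

Lemma enorm0 : enorm (0 : 'cV[R]_k) = 0.
Proof. by rewrite /enorm dot0r sqrtr0. Qed.

Lemma enormZ a u : enorm (a *: u) = `|a| * enorm u.
Proof. by rewrite /enorm dotZl dotZr mulrA -expr2 sqrtrM ?sqr_ge0// sqrtr_sqr. Qed.

Lemma enormN u : enorm (- u) = enorm u.
Proof. by rewrite -scaleN1r enormZ normrN1 mul1r. Qed.

Lemma cauchy_schwarz u v : dot u v <= enorm u * enorm v.
Proof.
have [->|v0] := eqVneq v 0; first by rewrite dot0r enorm0 mulr0.
have vv : 0 < dot v v.
  rewrite lt_neqAle dotvv_ge0 andbT eq_sym.
  by apply: contra v0 => /eqP/dotvv_eq0 ->.
apply: le_trans (ler_norm _) _.
rewrite -ler_sqr ?nnegrE ?normr_ge0 ?mulr_ge0 ?enorm_ge0//.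
rewrite real_normK ?num_real// exprMn !enorm_sqr.
(* This vector is [dot v v] times the component of [u] orthogonal to [v]; its
   squared norm is [dot v v] times the defect of the inequality. *)
have := dotvv_ge0 (dot v v *: u - dot u v *: v).
rewrite !dotE (dotC v u) => H.
rewrite -subr_ge0 -(pmulr_rge0 _ vv); apply: le_trans H _.
by rewrite le_eqVlt; apply/orP; left; apply/eqP; ring.
Qed.

Lemma enormD u v : enorm (u + v) <= enorm u + enorm v.
Proof.
rewrite enorm_le ?addr_ge0 ?enorm_ge0// !dotE -!enorm_sqr (dotC v u).
have := cauchy_schwarz u v; nra.
Qed.

Lemma enormB u v : enorm (u - v) <= enorm u + enorm v.
Proof. by rewrite -(enormN v) enormD. Qed.

(** Convexity with real weights and propositional membership instead of weights
    in the subtype [{i01 R}]. *)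
Lemma convex_setP K : convex_set K <->
  forall x y t, K x -> K y -> 0 <= t <= 1 -> K (t *: x + (1 - t) *: y).
Proof.
split=> [cK x y t Kx Ky t01|cK x y t].
  have := @cK x y (Itv01 (andP t01).1 (andP t01).2).
  by rewrite !inE; exact.
rewrite !inE => Kx Ky; apply: cK => //.
by rewrite ge0 le1.
Qed.

Lemma convex_average K (f : nat -> 'cV[R]_k) N : convex_set K ->
  (0 < N)%N -> (forall i, (i < N)%N -> K (f i)) ->
  K (N%:R^-1 *: \sum_(0 <= i < N) f i).
Proof.
move=> /convex_setP cK; elim: N => // -[|N] IH _ Kf.
  by rewrite big_nat1 invr1 scale1r; exact: Kf.
rewrite big_nat_recr//=; set p := N.+1 in IH Kf *.
have p0 : (p%:R : R) != 0 by rewrite pnatr_eq0.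
have p1 : (p.+1%:R : R) != 0 by rewrite pnatr_eq0.
have Kavg : K (p%:R^-1 *: \sum_(0 <= i < p) f i).
  by apply: IH => // i ip; apply: Kf; exact: ltnW.
(* The average of [p + 1] points is the combination of the last point, with
   weight [1 / (p + 1)], and of the average of the others. *)
have := cK _ _ p.+1%:R^-1 (Kf p (ltnSn p)) Kavg.
rewrite invr_ge0 ler0n invf_le1 ?ltr0n// ler1n /= => /(_ isT).
rewrite scalerA addrC scalerDr.
suff -> : (1 - p.+1%:R^-1) * p%:R^-1 = p.+1%:R^-1 :> R by [].
by rewrite -natr1; field; rewrite p0 natr1 p1.
Qed.

Lemma convex_eball r : convex_set (eball r : set 'cV[R]_k).
Proof.
apply/convex_setP => x y t; rewrite /eball/= => xr yr /andP[t0 t1].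
apply: le_trans (enormD _ _) _; rewrite !enormZ !ger0_norm ?subr_ge0//.
nra.
Qed.

Lemma convex_eball_nneg r : convex_set (eball_nneg r : set 'cV[R]_k).
Proof.
apply/convex_setP => x y t [xr x0] [yr y0] t01; split.
  by have /convex_setP := @convex_eball r; apply.
move=> i; have := x0 i; have := y0 i; case/andP: t01 => t0 t1; rewrite !mxE => yi xi.
by rewrite addr_ge0// mulr_ge0// subr_ge0.
Qed.

(** The derivative at [p] of the squared distance to [u], along the segment from
    [p] to [q], is [- 2 * dot (u - p) (q - p)]; at a minimum it is nonnegative. *)
Lemma nearest_variational K u p q : convex_set K -> K p ->
  (forall q, K q -> enorm (u - p) <= enorm (u - q)) ->
  K q -> dot (u - p) (q - p) <= 0.
Proof.
move=> /convex_setP cK Kp min Kq; rewrite leNgt; apply/negP => pos.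
set c := dot (u - p) (q - p) in pos *; set e := dot (q - p) (q - p).
have e0 : 0 <= e := dotvv_ge0 _.
have ce : 0 < c + e by rewrite ltr_wpDr.
(* Moving by [t] changes the squared distance by [t * (t * e - 2 * c)], which is
   negative for this [t], since [t * e = c - t * c < c]. *)
have [t [t0 t1 tce]] : exists t, [/\ 0 < t, t <= 1 & t * (c + e) = c].
  exists (c / (c + e)); split; rewrite ?divr_gt0 ?divfK ?gt_eqF//.
  by rewrite ler_pdivrMr// mul1r lerDl.
have Kt : K (t *: q + (1 - t) *: p) by apply: cK => //; rewrite (ltW t0).
have := min _ Kt; rewrite enorm_le ?enorm_ge0// enorm_sqr.
have -> : u - (t *: q + (1 - t) *: p) = (u - p) - t *: (q - p).
  by apply/matrixP => i j; rewrite !mxE; ring.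
move: (u - p) (q - p) @c @e pos e0 ce t0 t1 tce => a b.
move=> c e c0 e0 ce t0 t1 tce; rewrite !dotE (dotC b a) -/c -/e => H.
have : 2 * c <= t * e by rewrite -(ler_pM2l t0); lra.
have : 0 < t * c by rewrite mulr_gt0.
lra.
Qed.

Lemma vle0_closed : closed [set u : 'cV[R]_k | vle 0 u].
Proof.
have -> : [set u : 'cV[R]_k | vle 0 u] = \bigcap_i [set u : 'cV[R]_k | 0 <= u i 0].
  by apply/seteqP; split=> u H i; [move=> _; have := H i|have := H i I]; rewrite /= ?mxE.
apply: closed_bigI => i _.
apply: (@closed_comp _ _ (fun u : 'cV[R]_k => u i 0) [set x | 0 <= x]).
  by move=> x _; exact: coord_continuous.
exact: closed_ge.
Qed.

Lemma dot_continuous (T : topologicalType) (f g : T -> 'cV[R]_k) :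
  continuous f -> continuous g -> continuous (fun t => dot (f t) (g t)).
Proof.
have coord (h : T -> 'cV[R]_k) i : continuous h -> continuous (fun t => h t i 0).
  move=> ch x; apply: (@continuous_comp _ _ _ h (fun u => u i 0) x (ch x)).
  exact: coord_continuous.
move=> cf cg; rewrite /dot; pose h i t : R := f t i 0 * g t i 0.
apply: (@continuous_big R _ +%R 0 xpredT add_continuous _ _ h) => i _ x.
by apply: cvgM; exact: coord.
Qed.

Lemma enorm_continuous (T : topologicalType) (f : T -> 'cV[R]_k) :
  continuous f -> continuous (fun t => enorm (f t)).
Proof.
move=> cf x; apply: (@continuous_comp _ _ _ (fun t => dot (f t) (f t)) Num.sqrt x).
  exact: dot_continuous.
exact: sqrt_continuous.
Qed.

Lemma eball_closed r : closed (eball r : set 'cV[R]_k).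
Proof.
apply: (@closed_comp _ _ (fun u : 'cV[R]_k => enorm u) [set x | x <= r]);
  last exact: closed_le.
by move=> x _; apply: enorm_continuous => ?; exact: cvg_id.
Qed.

Lemma coord_le_enorm u i : `|u i 0| <= enorm u.
Proof.
rewrite -ler_sqr ?nnegrE ?normr_ge0 ?enorm_ge0// enorm_sqr.
rewrite real_normK ?num_real// /dot (bigD1 i)//= expr2 lerDl.
by apply: sumr_ge0 => j _; rewrite -expr2 sqr_ge0.
Qed.

Lemma continuous_entries (T : topologicalType) p q (f : T -> 'M[R]_(p, q)) :
  (forall i j, continuous (fun t => f t i j)) -> continuous f.
Proof.
move=> cf t; apply/cvg_ballP => e e0.
have : \forall s \near t, forall i j, ball (f t i j) e (f s i j).
  by apply: filter_forall => i; apply: filter_forall => j; exact: cvg_ball (cf i j t) _ e0.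
by apply: filterS => s H; split.
Qed.

Lemma trmx_continuous p q : continuous (trmx : 'M[R]_(p, q) -> 'M[R]_(q, p)).
Proof.
apply: continuous_entries => i j.
rewrite (_ : (fun _ => _) = fun M : 'M[R]_(p, q) => M j i); first exact: coord_continuous.
by apply/funext => M; rewrite mxE.
Qed.

(** Heine-Borel is known for row vectors, and transposition is a homeomorphism.
    The topology comes from the max norm, which the Euclidean norm dominates. *)
Lemma closed_eball_compact K r : closed K -> K `<=` eball r -> compact K.
Proof.
move=> clK Kr.
have -> : K = trmx @` [set v : 'rV[R]_k | K v^T].
  apply/seteqP; split=> [u Ku|_ [v Kv <-]//].
  by exists u^T => /=; rewrite ?trmxK.
apply: continuous_compact.
  by apply: continuous_subspaceT; exact: trmx_continuous.
apply: bounded_closed_compact.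
  exists (Num.max r 0); split; first exact: num_real.
  move=> M rM v /Kr vr; rewrite /= [leLHS]/Num.norm/= mx_normrE.
  apply/bigmax_leP; split.
    by apply: ltW; apply: le_lt_trans rM; rewrite le_max lexx orbT.
  move=> [i j] _ /=; rewrite ord1.
  have := coord_le_enorm v^T j; rewrite mxE => /le_trans; apply.
  by apply: le_trans vr _; apply: ltW; apply: le_lt_trans rM; rewrite le_max lexx.
by apply: (@closed_comp _ _ trmx K) => // v _; exact: trmx_continuous.
Qed.

Lemma eball_compact r : compact (eball r : set 'cV[R]_k).
Proof. by apply: (@closed_eball_compact _ r) => //; exact: eball_closed. Qed.

Lemma eball_nneg_compact r : compact (eball_nneg r : set 'cV[R]_k).
Proof.
apply: (@closed_eball_compact _ r) => [|u []//].
have -> : eball_nneg r = eball r `&` [set u | vle 0 u] by [].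
by apply: closedI; [exact: eball_closed|exact: vle0_closed].
Qed.

Lemma compact_nearest K u : compact K -> K !=set0 ->
  exists2 p, K p & forall q, K q -> enorm (u - p) <= enorm (u - q).
Proof.
move=> cK K0.
have cf : continuous (fun q : 'cV[R]_k => enorm (u - q)).
  apply: enorm_continuous => q.
  by apply: (@cvgB _ _ _ (nbhs q) _ (fun=> u) id u q); [exact: cvg_cst|exact: cvg_id].
have [p] := compact_EVT_min K0 cK (continuous_subspaceT cf).
by rewrite inE => Kp min; exists p => // q Kq; apply: min; rewrite inE.
Qed.

Lemma compact_enorm_bounded K : compact K -> exists M, forall u, K u -> enorm u <= M.
Proof.
move=> cK; have [K0|/set0P/negP/negPn/eqP ->] := pselect (K !=set0); last by exists 0.
have cf : continuous (fun q : 'cV[R]_k => enorm q).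
  by apply: enorm_continuous => q; exact: cvg_id.
have [p _ max] := compact_EVT_max K0 cK (continuous_subspaceT cf).
by exists (enorm p) => q Kq; apply: max; rewrite inE.
Qed.

Lemma eprojP K u : compact K -> K !=set0 ->
  K (eproj K u) /\ forall q, K q -> enorm (u - eproj K u) <= enorm (u - q).
Proof.
move=> cK K0; have [p Kp pmin] := compact_nearest u cK K0.
by rewrite /eproj; case: xgetP => [x _ //|/(_ p)]; case.
Qed.

(** At the projection, the directions to [u] and to [q] make an obtuse angle
    ([nearest_variational]), so [u] is the farther of the two from [q]. *)
Lemma eproj_contraction K u q : compact K -> convex_set K -> K q ->
  dot (eproj K u - q) (eproj K u - q) <= dot (u - q) (u - q).
Proof.
move=> coK cvK Kq; have [Kp min] := eprojP u coK (ex_intro _ q Kq).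
have := nearest_variational cvK Kp min Kq.
set p := eproj K u.
have -> : u - q = (u - p) + (p - q) by rewrite addrA subrK.
have -> : q - p = - (p - q) by rewrite opprB.
move: (u - p) (p - q) => a b; rewrite !dotE (dotC b a).
have := dotvv_ge0 a; lra.
Qed.

Lemma set_dist_le K u v : K v -> set_dist u K <= enorm (u - v).
Proof.
move=> Kv; apply: ge_inf; last by exists v.
by exists 0 => _ [x _ <-]; exact: enorm_ge0.
Qed.

End EuclideanGeometry.

(** * Projected gradient descent *)

(** The squared distance to the comparator [v] is a potential: the projection does
    not increase it, so step [i] lowers it by at least
    [2 eta <g_i, x_i - v> - eta^2 G^2].  Summing, the regret is at most
    [D^2 / (2 eta) + eta T G^2 / 2], and the step size [eta = D / (G sqrt T)]
    makes both terms equal to [D G sqrt T / 2]. *)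
Lemma ogd_regret (R : realType) (k : nat) (K : set 'cV[R]_k) (G D : R) (T : nat)
    (x g : nat -> 'cV[R]_k) (v : 'cV[R]_k) :
  compact K -> convex_set K -> 0 < G -> 0 < D -> (0 < T)%N ->
  (forall i, (i < T)%N ->
    x i.+1 = eproj K (x i - (D / (G * Num.sqrt T%:R)) *: g i)) ->
  (forall i, (i < T)%N -> enorm (g i) <= G) ->
  K v -> enorm (x 0%N - v) <= D ->
  \sum_(0 <= i < T) dot (g i) (x i - v) <= D * G * Num.sqrt T%:R.
Proof.
move=> coK cvK G0 D0 T0 xS gG Kv xv.
set sT := Num.sqrt T%:R in xS *.
have sT0 : 0 < sT by rewrite sqrtr_gt0 ltr0n.
have sTT : sT ^+ 2 = T%:R by rewrite sqr_sqrtr// ler0n.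
set eta := D / (G * sT) in xS.
have eta0 : 0 < eta by rewrite divr_gt0// mulr_gt0.
have etaE : eta * (G * sT) = D by rewrite divfK// mulf_neq0 ?gt_eqF.
have key n : (n <= T)%N ->
    dot (x n - v) (x n - v) + 2 * eta * \sum_(0 <= i < n) dot (g i) (x i - v)
      <= D ^+ 2 + n%:R * (eta ^+ 2 * G ^+ 2).
  elim: n => [|n IH] nT.
    by rewrite big_geq// mulr0 mul0r !addr0 -enorm_le// ltW.
  have {IH} := IH (ltnW nT); rewrite big_nat_recr//= -natr1.
  set s := \sum_(_ <= _ < _) _ => IH.
  have := eproj_contraction (x n - eta *: g n) coK cvK Kv.
  rewrite -xS//.
  have -> : x n - eta *: g n - v = (x n - v) - eta *: g n by rewrite addrAC.
  have : dot (g n) (g n) <= G ^+ 2 by rewrite -enorm_le ?gG// ltW.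
  move: IH; move: (x n.+1 - v) (x n - v) (g n) => a b c.
  rewrite !dotE (dotC b c) => IH cG step.
  have : eta ^+ 2 * dot c c <= eta ^+ 2 * G ^+ 2 by rewrite ler_pM2l// exprn_gt0.
  nra.
have {key} := key T (leqnn T).
set s := \sum_(_ <= _ < _) _.
have -> : D ^+ 2 + T%:R * (eta ^+ 2 * G ^+ 2) = 2 * eta * (D * G * sT).
  by rewrite -sTT -etaE; ring.
have := dotvv_ge0 (x T - v) => d0 H.
by rewrite -(ler_pM2l (mulr_gt0 (ltr0n R 2) eta0)); lra.
Qed.

(** * Support functions and distances *)

Section SupportFunction.
Context {R : realType} {k : nat}.
Implicit Types (u v w z g : 'cV[R]_k) (K : set 'cV[R]_k).

Lemma support_fun_ge K w v M : (forall z, K z -> enorm z <= M) -> K v ->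
  dot w v <= support_fun K w.
Proof.
move=> KM Kv; apply: ub_le_sup; last by exists v.
exists (enorm w * M) => _ [z Kz <-].
by apply: le_trans (cauchy_schwarz _ _) _; rewrite ler_wpM2l ?enorm_ge0// KM.
Qed.

Lemma support_fun_le K w c : K !=set0 -> (forall v, K v -> dot w v <= c) ->
  support_fun K w <= c.
Proof.
move=> [v Kv] H; apply: ge_sup; first by exists (dot w v); exists v.
by move=> _ [z Kz <-]; exact: H.
Qed.

(** The unit vector pointing from the nearest point [p] to [z] separates: its
    support value over [K] is attained at [p], so its gap is the distance. *)
Lemma support_distance K z c : compact K -> convex_set K -> K !=set0 -> 0 <= c ->
  (forall w, eball 1 w -> dot w z - support_fun K w <= c) ->
  exists2 p, K p & enorm (z - p) <= c.
Proof.
move=> coK cvK K0 c0 H; have [p Kp pmin] := compact_nearest z coK K0.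
exists p => //; have [->//|zp] := eqVneq (enorm (z - p)) 0.
have zp0 : 0 < enorm (z - p) by rewrite lt_neqAle eq_sym zp enorm_ge0.
set e := enorm (z - p) in zp zp0 *; pose w := e^-1 *: (z - p).
have /H : eball 1 w by rewrite /eball/= enormZ ger0_norm ?invr_ge0 ?enorm_ge0// mulVf.
apply: le_trans; rewrite lerBrDr.
have le_supp : support_fun K w <= dot w p.
  apply: support_fun_le => // v Kv.
  rewrite -subr_le0 -dotNr -dotDr dotZl pmulr_rle0 ?invr_gt0//.
  exact: nearest_variational pmin Kv.
suff : dot w z = e + dot w p by move=> ->; rewrite lerD2l.
apply/eqP; rewrite -subr_eq -dotNr -dotDr dotZl -enorm_sqr -/e expr2.
by rewrite mulKf.
Qed.

(** The objective is a supremum of affine functions of slopes [z - loss], hence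
    [G]-Lipschitz; moving by [g] itself raises it by at least [dot g g], so
    [dot g g <= G * enorm g]. *)
Lemma subgradient_bound K loss w g M G : K !=set0 ->
  (forall z, K z -> enorm z <= M) -> (forall z, K z -> enorm (z - loss) <= G) ->
  is_subgradient (outer_obj K loss) w g -> enorm g <= G.
Proof.
move=> K0 KM KG /(_ (w + g)).
rewrite /outer_obj (addrC w g) addrK.
have : support_fun K (g + w) <= support_fun K w + dot g loss + enorm g * G.
  apply: support_fun_le => // z Kz.
  have := support_fun_ge w KM Kz; have := cauchy_schwarz g (z - loss).
  have := ler_wpM2l (enorm_ge0 g) (KG z Kz).
  rewrite !dotE; lra.
rewrite !dotE -enorm_sqr => A B.
have [->|g0] := eqVneq (enorm g) 0.
  by have [z Kz] := K0; apply: le_trans (KG z Kz); exact: enorm_ge0.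
have gp : 0 < enorm g by rewrite lt_neqAle eq_sym g0 enorm_ge0.
by rewrite -(ler_pM2l gp); lra.
Qed.

End SupportFunction.

(** * Operator norms and the bilinear loss *)

Section OperatorNorms.
Context {R : realType}.

Lemma enorm_sum (k : nat) I (s : seq I) (F : I -> 'cV[R]_k) :
  enorm (\sum_(i <- s) F i) <= \sum_(i <- s) enorm (F i).
Proof.
elim: s => [|a s IH]; first by rewrite !big_nil enorm0.
by rewrite !big_cons; apply: le_trans (enormD _ _) _; rewrite lerD2l.
Qed.

Lemma eball0 (k : nat) (r : R) : 0 <= r -> eball r (0 : 'cV[R]_k).
Proof. by rewrite /eball/= enorm0. Qed.

Lemma spectral_norm_le (n m : nat) (A : 'M[R]_(n, m)) c :
  (forall v, eball 1 v -> enorm (A *m v) <= c) -> spectral_norm A <= c.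
Proof.
move=> H; apply: ge_sup => [|_ [v v1 <-]]; last exact: H.
by exists (enorm (A *m 0)); exists 0 => //; exact: eball0.
Qed.

(** The supremum is over a bounded set: each coordinate of [v] is at most one in
    absolute value, so the norms of the columns add up to a bound. *)
Lemma spectral_norm_ub (n m : nat) (A : 'M[R]_(n, m)) v : eball 1 v ->
  enorm (A *m v) <= spectral_norm A.
Proof.
move=> v1; apply: ub_le_sup; last by exists v.
exists (\sum_j enorm (col j A)) => _ [u u1 <-].
have -> : A *m u = \sum_j u j 0 *: col j A.
  apply/matrixP => i l; rewrite ord1 mxE summxE.
  by apply: eq_bigr => j _; rewrite !mxE mulrC.
apply: le_trans (enorm_sum _ _) _; apply: ler_sum => j _.
rewrite enormZ ler_piMl ?enorm_ge0//.
exact: le_trans (coord_le_enorm u j) u1.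
Qed.

Lemma spectral_normP (n m : nat) (A : 'M[R]_(n, m)) v :
  enorm (A *m v) <= spectral_norm A * enorm v.
Proof.
have [v0|v0] := eqVneq (enorm v) 0.
  by rewrite (enorm_eq0 v0) mulmx0 !enorm0 mulr0.
have vp : 0 < enorm v by rewrite lt_neqAle eq_sym v0 enorm_ge0.
have := @spectral_norm_ub _ _ A ((enorm v)^-1 *: v).
rewrite /eball/= enormZ -scalemxAr enormZ ger0_norm ?invr_ge0 ?enorm_ge0//.
by rewrite mulVf// lexx => /(_ isT); rewrite ler_pdivrMl// mulrC.
Qed.

Context {n m d : nat} (L : 'I_d -> 'M[R]_(n, m)).

(** Boundedness of the supremum is by the same argument, with the matrices [L i]
    in place of the columns. *)
Lemma bilinear_norm_ub w : eball 1 w ->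
  spectral_norm (lincomb_mx L w) <= bilinear_norm L.
Proof.
move=> w1; apply: ub_le_sup; last by exists w.
exists (\sum_i spectral_norm (L i)) => _ [u u1 <-].
apply: spectral_norm_le => v v1; rewrite /lincomb_mx mulmx_suml.
apply: le_trans (enorm_sum _ _) _; apply: ler_sum => j _.
rewrite -scalemxAl enormZ; apply: le_trans (spectral_norm_ub _ v1).
by rewrite ler_piMl ?enorm_ge0//; exact: le_trans (coord_le_enorm u j) u1.
Qed.

Lemma bilinear_norm_ge0 : 0 <= bilinear_norm L.
Proof.
have B0 : eball 1 (0 : 'cV[R]_d) by exact: eball0.
apply: le_trans (bilinear_norm_ub B0).
have C0 : eball 1 (0 : 'cV[R]_m) by exact: eball0.
by apply: le_trans (spectral_norm_ub _ C0); exact: enorm_ge0.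
Qed.

Lemma enorm_lincomb_mx w y : eball 1 w ->
  enorm (lincomb_mx L w *m y) <= bilinear_norm L * enorm y.
Proof.
move=> w1; apply: le_trans (spectral_normP _ _) _.
by rewrite ler_wpM2r ?enorm_ge0// bilinear_norm_ub.
Qed.

Lemma dot_mulmx (k : nat) (u v : 'cV[R]_k) : dot u v = (u^T *m v) 0 0.
Proof. by rewrite mxE; apply: eq_bigr => i _; rewrite mxE. Qed.

Lemma dot_trmx (A : 'M[R]_(n, m)) x y : dot x (A *m y) = dot (A^T *m x) y.
Proof. by rewrite !dot_mulmx trmx_mul trmxK mulmxA. Qed.

Context (ell : 'cV[R]_n -> 'cV[R]_m -> 'cV[R]_d) (ellL : is_coord_mx ell L).

Lemma dot_coord_mx w x y : dot w (ell x y) = dot x (lincomb_mx L w *m y).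
Proof.
rewrite /lincomb_mx mulmx_suml dot_sumr; apply: eq_bigr => i _.
by rewrite ellL -scalemxAl dotZr dot_mulmx mulmxA.
Qed.

(** Test the loss against its own direction [w]: [dot w (ell x y)] is a matrix
    form whose matrix has spectral norm at most [bilinear_norm L]. *)
Lemma enorm_bilinear x y : enorm (ell x y) <= bilinear_norm L * enorm x * enorm y.
Proof.
have [->|e0] := eqVneq (enorm (ell x y)) 0.
  by rewrite !mulr_ge0 ?enorm_ge0 ?bilinear_norm_ge0.
have ep : 0 < enorm (ell x y) by rewrite lt_neqAle eq_sym e0 enorm_ge0.
set e := enorm (ell x y) in e0 ep *; pose w := e^-1 *: ell x y.
have w1 : eball 1 w by rewrite /eball/= enormZ ger0_norm ?invr_ge0 ?enorm_ge0// mulVf.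
have <- : dot w (ell x y) = e by rewrite dotZl -enorm_sqr -/e expr2 mulKf.
rewrite dot_coord_mx; apply: le_trans (cauchy_schwarz _ _) _.
rewrite mulrAC mulrC ler_wpM2r ?enorm_ge0//.
exact: enorm_lincomb_mx.
Qed.

End OperatorNorms.

(** * The extended oracle *)

Section ExtendedOracle.
Context {R : realType} {m : nat}.
Implicit Types (c q : 'cV[R]_m) (Y : set 'cV[R]_m).

Lemma pos_neg_part c : c = pos_part c + neg_part c.
Proof.
by apply/matrixP => i j; rewrite ord1 !mxE; case: ltrP => _; rewrite ?addr0 ?add0r.
Qed.

Lemma pos_part_ge0 c : vle 0 (pos_part c).
Proof. by move=> i; rewrite !mxE; case: ifP. Qed.

Lemma neg_part_le0 c : vle 0 (- neg_part c).
Proof. by move=> i; rewrite !mxE; case: ifP; rewrite ?oppr0// oppr_ge0 => /ltW. Qed.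

Lemma enorm_unit_vec q : enorm (unit_vec q) <= 1.
Proof.
rewrite /unit_vec; case: eqVneq => [_|q0]; first by rewrite enorm0.
rewrite enormZ ger0_norm ?invr_ge0 ?enorm_ge0// mulVf//.
by apply: contra q0 => /eqP/enorm_eq0 ->.
Qed.

Lemma dot_unit_vec q : dot (unit_vec q) q = enorm q.
Proof.
rewrite /unit_vec; case: eqVneq => [->|q0]; first by rewrite dot0r enorm0.
rewrite dotZl -enorm_sqr expr2 mulKf//.
by apply: contra q0 => /eqP/enorm_eq0 ->.
Qed.

Lemma unit_vec_ge0 q : vle 0 q -> vle 0 (unit_vec q).
Proof.
rewrite /unit_vec; case: eqVneq => [_ _ i|_ q0 i]; first exact: lexx.
by have := q0 i; rewrite !mxE => ?; rewrite mulr_ge0// invr_ge0 enorm_ge0.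
Qed.

Context (Y : set 'cV[R]_m) (alpha RY : R) (O : 'cV[R]_m -> 'cV[R]_m).
Context (Yge0 : forall y, Y y -> vle 0 y).
Context (YRY : forall y, Y y -> enorm y <= RY).
Context (alpha0 : 0 < alpha).
Context (OY : is_approx_oracle Y alpha O).

(** The first component of the answer of [ext_oracle]. *)
Definition ext_answer c : 'cV[R]_m :=
  O (- neg_part c) - RY *: unit_vec (pos_part c).

Lemma oracle_mem c : Y (O (- neg_part c)).
Proof. exact: (OY (neg_part_le0 c)).1. Qed.

Lemma radius_ge0 : 0 <= RY.
Proof. exact: le_trans (enorm_ge0 _) (YRY (oracle_mem 0)). Qed.

(** The oracle handles the coordinates where [c] is negative: minimizing over [Y]
    there is maximizing against [- neg_part c], which is nonnegative.  On the
    others the shift by [- RY * unit_vec (pos_part c)] contributes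
    [- RY * enorm (pos_part c)], which cancels whatever the point of [Y] chosen by
    the oracle could pay there, and [y], being nonnegative, pays at least zero. *)
Lemma ext_answer_le c y : Y y -> dot (ext_answer c) c <= alpha * dot y c.
Proof.
move=> Yy; rewrite /ext_answer; have [Yz Oz] := OY (neg_part_le0 c).
set z := O _ in Yz Oz *.
have sup_ge : dot y (- neg_part c) <= sup [set dot y (- neg_part c) | y in Y].
  apply: ub_le_sup; last by exists y.
  exists (RY * enorm (- neg_part c)) => _ [v Yv <-].
  by apply: le_trans (cauchy_schwarz _ _) _; rewrite ler_wpM2r ?enorm_ge0 ?YRY.
have zp : dot z (pos_part c) <= RY * enorm (pos_part c).
  apply: le_trans (cauchy_schwarz _ _) _.
  by rewrite ler_wpM2r ?enorm_ge0 ?YRY.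
have yp : 0 <= dot y (pos_part c).
  have := dot_vle (pos_part_ge0 c) (Yge0 Yy).
  by rewrite dotC dot0r.
have u0 : dot (unit_vec (pos_part c)) (neg_part c) = 0.
  have D0 : dot (pos_part c) (neg_part c) = 0.
    by apply: big1 => i _; rewrite !mxE; case: ltrP; rewrite ?mul0r ?mulr0.
  rewrite /unit_vec; case: ifP => _; first by rewrite dotC dot0r.
  by rewrite dotZl D0 mulr0.
have split_c v : dot v c = dot v (pos_part c) + dot v (neg_part c).
  by rewrite {1}[c]pos_neg_part dotDr.
rewrite !split_c !dotE u0 dot_unit_vec.
have := ler_wpM2l (ltW alpha0) sup_ge; have := mulr_ge0 (ltW alpha0) yp.
move: Oz; rewrite !dotE; lra.
Qed.

Lemma ext_answer_norm c : enorm (ext_answer c) <= 2 * RY.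
Proof.
apply: le_trans (enormB _ _) _; rewrite enormZ ger0_norm ?radius_ge0//.
have := YRY (oracle_mem c); have := ler_wpM2l radius_ge0 (enorm_unit_vec (pos_part c)).
lra.
Qed.

End ExtendedOracle.

(** * Execution of the inner loop *)

Section InnerLoop.
Context {R : realType} {n m : nat}.

Lemma qrun_bind (Q A B C : Type) (f : Q -> A) (p : qcomp Q A B)
    (h : B -> qcomp Q A C) :
  qrun f (qbind p h)
  = ((qrun f (h (qrun f p).1)).1, ((qrun f p).2 + (qrun f (h (qrun f p).1)).2)%N).
Proof. by elim: p => [b|q g IH] /=; [case: (qrun f (h b))|rewrite IH]. Qed.

Context (X : set 'cV[R]_n) (O : 'cV[R]_m -> 'cV[R]_m) (RY mu : R).
Context (A : 'M[R]_(n, m)).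

Definition inner_step (u : 'cV[R]_n) : 'cV[R]_n :=
  eproj X (u - mu *: (A *m ext_answer RY O (- (A^T *m u)))).

Lemma qrun_inner_loop N u :
  qrun O (inner_loop X RY mu A N u) = (traject inner_step u N, N).
Proof.
elim: N u => [//|N IH] u; rewrite /= qrun_bind /= -/(inner_step u) IH/=.
by rewrite addn0.
Qed.

Lemma traject_iota (T : Type) (f : T -> T) (x : T) N :
  traject f x N = [seq iter i f x | i <- iota 0 N].
Proof.
elim: N x => [//|N IH] x; rewrite trajectS IH/= (iotaDl 1 0) -map_comp; congr (_ :: _).
by apply: eq_map => i /=; rewrite -iterSr.
Qed.

Lemma qrun_inner_average N u :
  qrun O (inner_average X RY mu A N u)
  = (N%:R^-1 *: \sum_(0 <= i < N) iter i inner_step u, N).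
Proof.
rewrite qrun_bind qrun_inner_loop/= addn0 traject_iota big_map.
by rewrite /index_iota subn0.
Qed.

End InnerLoop.

(** * Approachable instances and the relaxed target *)

Section BlackwellInstance.
Context {R : realType} {n m d : nat}.
Context (X : set 'cV[R]_n) (Y : set 'cV[R]_m)
  (ell : {bilinear 'cV[R]_n -> 'cV[R]_m -> 'cV[R]_d}) (S : set 'cV[R]_d)
  (L : 'I_d -> 'M[R]_(n, m)).
Context (inst : blackwell_instance X Y ell S) (coS : compact S)
  (ellL : is_coord_mx ell L).

(** Let the adversary play [q] forever.  The losses average to the loss of the
    average move, which is in [X] by convexity, so [ell x q] comes arbitrarily
    close to [S]; compactness of [X] and [S] makes the infimum zero a minimum. *)
Lemma approachable_response q : approachable X Y ell S -> Y q ->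
  exists2 x, X x & S (ell x q).
Proof.
move=> [strat stratP] Yq; have [Xx cvg0] := stratP (fun=> q) (fun=> Yq).
pose x t := strat (mkseq (fun=> q) t); have {}Xx t : X (x t) by exact: Xx.
pose F (t : 'cV[R]_n * 'cV[R]_d) := ell t.1 q - t.2.
have cF : continuous F.
  apply: continuous_entries => i j; rewrite ord1.
  rewrite (_ : (fun _ => _) = fun t : 'cV[R]_n * 'cV[R]_d =>
    dot t.1 (L i *m q) - t.2 i 0); last first.
    by apply/funext => t; rewrite !mxE ellL dot_mulmx mulmxA.
  move=> t; apply: (@cvgB _ _ _ (nbhs t)).
    apply: dot_continuous => [u|u]; [exact: cvg_fst|exact: cvg_cst].
  apply: (@continuous_comp _ _ _ snd (fun s : 'cV[R]_d => s i 0)); first exact: cvg_snd.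
  exact: coord_continuous.
have [x1 Xx1] := instX_neq0 inst; have [s1 Ss1] := instS_neq0 inst.
have [[x0 s0]] : exists2 c, c \in X `*` S &
    forall t, t \in X `*` S -> enorm (F c) <= enorm (F t).
  apply: compact_EVT_min; first by exists (x1, s1).
    exact: compact_setX (instX_compact inst) coS.
  by apply: continuous_subspaceT; exact: enorm_continuous.
rewrite inE => -[/= Xx0 Ss0] Fmin.
exists x0 => //; suff /enorm_eq0/eqP : enorm (F (x0, s0)) = 0.
  by rewrite subr_eq0 => /eqP ->.
apply/eqP; rewrite eq_le enorm_ge0 andbT.
apply: cvgr_to_ge cvg0 _; exists 1%N => // T /= T0.
apply: lb_le_inf; first by exists (enorm (T%:R^-1 *: \sum_(t < T) ell (x t) q - s1)), s1.
move=> _ [s Ss <-].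
have -> : T%:R^-1 *: \sum_(t < T) ell (x t) q - s
    = F (T%:R^-1 *: \sum_(0 <= t < T) x t, s).
  by rewrite /F/= linearZl_LR/= linear_sumlz/= big_mkord.
apply: Fmin; rewrite inE; split=> //=.
exact: convex_average (instX_convex inst) T0 _.
Qed.

Context (alpha r : R) (alpha0 : 0 < alpha) (r0 : 0 <= r).
Let K := S_tilde S alpha r.

Lemma S_tilde_compact : compact K.
Proof.
have -> : K = (fun t => alpha^-1 *: (t.1 - t.2)) @` (S `*` eball_nneg r).
  apply/seteqP; split=> [_ [s Ss [b Bb <-]]|_ [[s b] [/= Ss Bb] <-]].
    by exists (s, b).
  by exists s => //; exists b.
apply: continuous_compact; last exact: compact_setX coS (@eball_nneg_compact _ _ r).
apply: continuous_subspaceT => t.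
apply: (@continuous_comp _ _ _ (fun t : 'cV[R]_d * 'cV[R]_d => t.1 - t.2)
  (fun s : 'cV[R]_d => alpha^-1 *: s)); last exact: scaler_continuous.
by apply: (@cvgB _ _ _ (nbhs t)); [exact: cvg_fst|exact: cvg_snd].
Qed.

Lemma S_tilde_convex : convex_set K.
Proof.
apply/convex_setP => _ _ t [s Ss [b Bb <-]] [s' Ss' [b' Bb' <-]] t01.
exists (t *: s + (1 - t) *: s').
  by have /convex_setP := instS_convex inst; apply.
exists (t *: b + (1 - t) *: b').
  by have /convex_setP := @convex_eball_nneg R d r; apply.
by apply/matrixP => i j; rewrite !mxE; ring.
Qed.

Lemma S_tilde_neq0 : K !=set0.
Proof.
have [s Ss] := instS_neq0 inst.
exists (alpha^-1 *: (s - 0)), s => //; exists 0 => //.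
by split=> [|i]; [exact: eball0|exact: lexx].
Qed.

Lemma S_tilde_down p : K p -> down_closure [set alpha^-1 *: z | z in S] p.
Proof.
move=> [s Ss [b [_ b0] <-]]; exists (alpha^-1 *: s); first by exists s.
move=> i; have := b0 i; rewrite !mxE => bi.
by rewrite ler_wpM2l ?invr_ge0 ?(ltW alpha0)// gerBl.
Qed.

Context (RX RY : R) (XRX : forall x, X x -> enorm x <= RX)
  (YRY : forall y, Y y -> enorm y <= RY).

Lemma enorm_loss x y : X x -> Y y -> enorm (ell x y) <= R_tilde L RX RY.
Proof.
move=> Xx Yy; apply: le_trans (enorm_bilinear ellL x y) _.
rewrite /R_tilde -!mulrA ler_wpM2l ?bilinear_norm_ge0//.
by rewrite ler_pM ?enorm_ge0// ?XRX ?YRY.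
Qed.

Lemma G_3_ub z x y : K z -> X x -> Y y ->
  enorm (z - ell x y) <= G_3 X Y ell S alpha r.
Proof.
move=> Kz Xx Yy; have [M KM] := compact_enorm_bounded S_tilde_compact.
apply: ub_le_sup; last first.
  by have [s Ss [b Bb <-]] := Kz; exists s, b, x, y.
exists (M + R_tilde L RX RY) => _ [s [b [x' [y' [Ss Bb Xx' Yy' ->]]]]].
apply: le_trans (enormB _ _) _; apply: lerD; last exact: enorm_loss.
by apply: KM; exists s => //; exists b.
Qed.

End BlackwellInstance.

Lemma num_innerP (R : realType) (alpha GX DX : R) (T : nat) :
  let q := GX ^+ 2 * DX ^+ 2 * T%:R / alpha ^+ 2 in
  0 < q -> q <= (num_inner alpha GX DX T)%:R <= q + 1.
Proof.
move=> q q0; rewrite /num_inner -/q.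
have c0 : 0 < Num.ceil q by rewrite ceil_gt_int.
have -> : (`|Num.ceil q|%N)%:R = (Num.ceil q)%:~R :> R.
  by rewrite -[in RHS](gtz0_abs c0).
have /andP[] := ceil_itv q; rewrite intrB => A ->/=.
by rewrite -lerBlDr ltW.
Qed.

(** * Guarantees of the algorithm *)

Lemma sqrtr_divE (R : rcfType) (a : R) : 0 < a -> Num.sqrt a = a / Num.sqrt a.
Proof.
move=> a0; apply: (canRL (mulfK _)); first by rewrite gt_eqF// sqrtr_gt0.
by rewrite -expr2 sqr_sqrtr// ltW.
Qed.

Section Rounds.
Context {R : realType} {n m d : nat}.
Context (X : set 'cV[R]_n) (Y : set 'cV[R]_m)
  (ell : {bilinear 'cV[R]_n -> 'cV[R]_m -> 'cV[R]_d}) (S : set 'cV[R]_d)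
  (L : 'I_d -> 'M[R]_(n, m)) (O : 'cV[R]_m -> 'cV[R]_m) (alpha RX RY DX : R).
Context (inst : blackwell_instance X Y ell S)
  (Xge0 : forall x, X x -> vle 0 x) (Yge0 : forall y, Y y -> vle 0 y)
  (coS : compact S) (apprS : approachable X Y ell S)
  (ell_ge0 : forall x y, vle 0 x -> vle 0 y -> vle 0 (ell x y))
  (ellL : is_coord_mx ell L) (alpha01 : 0 < alpha <= 1)
  (OY : is_approx_oracle Y alpha O)
  (XRX : forall x, X x -> enorm x <= RX) (YRY : forall y, Y y -> enorm y <= RY)
  (XDX : forall x x', X x -> X x' -> enorm (x - x') <= DX).

Let r := R_tilde L RX RY.
Let GX := G_X L alpha RY.
Let K := S_tilde S alpha r.
Context (GX0 : 0 < GX) (DX0 : 0 < DX).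

Let alpha0 : 0 < alpha. Proof. by case/andP: alpha01. Qed.

Let RY0 : 0 <= RY. Proof. exact: (radius_ge0 YRY OY). Qed.

Lemma R_tilde_ge0 : 0 <= r.
Proof.
have [x Xx] := instX_neq0 inst; have [y Yy] := instY_neq0 inst.
exact: le_trans (enorm_ge0 _) (enorm_loss ellL XRX YRY Xx Yy).
Qed.

(** The point [q - RY *: e] need not lie in [Y], so no response to it is available.
    Responding to [q] instead changes the loss by [ell x (RY *: e)], a nonnegative
    vector of norm at most [r], and [S_tilde] is large enough to absorb it. *)
Lemma response_support w q e : Y q -> eball_nneg 1 e ->
  exists2 x, X x &
    dot x (lincomb_mx L w *m (q - RY *: e)) <= alpha * support_fun K w.
Proof.
move=> Yq [e1 e0]; have [x Xx Sx] := approachable_response inst coS ellL apprS Yq.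
exists x => //; rewrite -(dot_coord_mx ellL) linearBr.
set b := ell x (RY *: e).
have Bb : eball_nneg r b.
  split; last first.
    apply: ell_ge0; first exact: Xge0.
    by move=> i; have := e0 i; rewrite !mxE => ei; rewrite mulr_ge0.
  apply: le_trans (enorm_bilinear ellL _ _) _.
  rewrite /r /R_tilde -!mulrA ler_wpM2l ?bilinear_norm_ge0//.
  rewrite ler_pM ?enorm_ge0// ?XRX// enormZ ger0_norm//.
  by rewrite ler_piMr.
have -> : ell x q - b = alpha *: (alpha^-1 *: (ell x q - b)).
  by rewrite scalerA divff ?scale1r// gt_eqF.
rewrite dotZr ler_pM2l//.
have [M KM] := compact_enorm_bounded (S_tilde_compact coS (alpha := alpha) (r := r)).
by apply: support_fun_ge KM _; exists (ell x q) => //; exists b.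
Qed.

(** Every iterate [u i] satisfies [alpha * <u i, A y> <= <u i, A (p i)>], and the
    right-hand sides are compared by the regret bound with those of one fixed [x],
    chosen as the response to the average of the [p i]. *)
Lemma inner_guarantee w u1 N y : eball 1 w -> X u1 -> (0 < N)%N -> Y y ->
  let u := N%:R^-1 *: \sum_(0 <= i < N)
    iter i (inner_step X O RY (step_inner GX DX N) (lincomb_mx L w)) u1 in
  X u /\ alpha * dot w (ell u y)
         <= alpha * support_fun K w + DX * GX / Num.sqrt N%:R.
Proof.
move=> w1 Xu1 N0 Yy; set A := lincomb_mx L w.
set step := inner_step _ _ _ _ _; pose u i := iter i step u1.
have coX := instX_compact inst; have cvX := instX_convex inst.
have Xu i : X (u i).
  by case: i => [//|i]; rewrite /u iterS; exact: (eprojP _ coX (instX_neq0 inst)).1.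
move=> ubar; have Xubar : X ubar by exact: convex_average cvX N0 (fun i _ => Xu i).
split=> //.
pose c i := - (A^T *m u i); pose p i := ext_answer RY O (c i).
have pA i : alpha * dot (u i) (A *m y) <= dot (A *m p i) (u i).
  have := ext_answer_le Yge0 YRY alpha0 OY (c i) Yy.
  rewrite -/(p i) /c !dotNr !(dotC _ (A^T *m _)) -!dot_trmx mulrN lerN2.
  by rewrite (dotC (A *m p i)).
have gG i : enorm (A *m p i) <= GX.
  apply: le_trans (enorm_lincomb_mx _ _ w1) _.
  rewrite /GX /G_X mulrC -mulrA [leRHS]mulrA [leRHS]mulrAC ler_wpM2r ?bilinear_norm_ge0//.
  apply: le_trans (ext_answer_norm YRY OY (c i)) _.
  by rewrite ler_wpM2r// lerDr ltW.
(* The average of the answers [p i] is [q - RY *: e]. *)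
pose q := N%:R^-1 *: \sum_(0 <= i < N) O (- neg_part (c i)).
pose e := N%:R^-1 *: \sum_(0 <= i < N) unit_vec (pos_part (c i)).
have Yq : Y q.
  by apply: convex_average (instY_convex inst) N0 _ => i _; exact: oracle_mem OY _.
have Be : eball_nneg 1 e.
  apply: convex_average (@convex_eball_nneg R m 1) N0 _ => i _; split.
    exact: enorm_unit_vec.
  exact/unit_vec_ge0/pos_part_ge0.
have [x Xx xle] := response_support w Yq Be.
have N0R : 0 < N%:R :> R by rewrite ltr0n.
have avg (k : nat) (f : nat -> 'cV[R]_k) :
    \sum_(0 <= i < N) f i = N%:R *: (N%:R^-1 *: \sum_(0 <= i < N) f i).
  by rewrite scalerA divff ?scale1r// gt_eqF.
have := @ogd_regret R n X GX DX N u (fun i => A *m p i) x coX cvX GX0 DX0 N0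
  (fun i _ => erefl) (fun i _ => gG i) Xx (XDX (Xu 0%N) Xx).
under eq_bigr do rewrite dotDr dotNr.
rewrite sumrB.
have -> : \sum_(0 <= i < N) dot (A *m p i) x = N%:R * dot x (A *m (q - RY *: e)).
  under eq_bigr do rewrite dotC.
  rewrite -dot_sumr -mulmx_sumr -dotZr scalemxAr; congr (dot x (A *m _)).
  rewrite scalerBr (scalerA N%:R RY) (mulrC N%:R) -scalerA /q /e -!avg.
  by rewrite scaler_sumr -sumrB.
have lower : N%:R * (alpha * dot w (ell ubar y)) <= \sum_(0 <= i < N) dot (A *m p i) (u i).
  rewrite (dot_coord_mx ellL) -/A mulrCA.
  have -> : N%:R * dot ubar (A *m y) = \sum_(0 <= i < N) dot (u i) (A *m y).
    by rewrite -dotZl -avg dotC dot_sumr; apply: eq_bigr => i _; rewrite dotC.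
  by rewrite mulr_sumr; apply: ler_sum.
have sqN := sqrtr_divE N0R.
rewrite {1}sqN => upper.
rewrite -(ler_pM2l N0R); have := ler_wpM2l (ltW N0R) xle.
move: upper lower; lra.
Qed.

Section Play.
Context (T : nat) (T0 : (1 <= T)%N).
Let G3 := G_3 X Y ell S alpha r.
Let N := num_inner alpha GX DX T.
Context (G30 : 0 < G3).
Context (w : nat -> 'cV[R]_d) (u1 s : nat -> 'cV[R]_n) (y : nat -> 'cV[R]_m)
  (g : nat -> 'cV[R]_d) (calls : nat -> nat).
Context (exec : execution X Y ell L O K RY
    (step_outer G3 T) (step_inner GX DX N) N T w u1 s y g calls).

Let q := GX ^+ 2 * DX ^+ 2 * T%:R / alpha ^+ 2.

Let q0 : 0 < q.
Proof.
apply: divr_gt0; last by rewrite exprn_gt0.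
by apply: mulr_gt0; [apply: mulr_gt0; rewrite exprn_gt0|rewrite ltr0n].
Qed.

Let qN : q <= N%:R <= q + 1. Proof. exact: num_innerP. Qed.

Let N0 : (0 < N)%N.
Proof. by have /andP[qle _] := qN; rewrite -(ltr0n R); exact: lt_le_trans qle. Qed.

Lemma play_calls t : (1 <= t <= T)%N ->
  calls t = N /\ s t = N%:R^-1 *: \sum_(0 <= i < N)
    iter i (inner_step X O RY (step_inner GX DX N) (lincomb_mx L (w t))) (u1 t).
Proof. by move=> /(exec_play exec); rewrite qrun_inner_average => -[-> ->]. Qed.

Lemma w_eball t : (1 <= t <= T.+1)%N -> eball 1 (w t).
Proof.
case: t => // -[|t] tT; first exact: exec_init exec.
rewrite (exec_update exec)//.
have [] // := eprojP (w t.+1 - step_outer G3 T *: g t.+1) (@eball_compact R d 1).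
by exists 0; exact: eball0.
Qed.

(** [N >= GX^2 DX^2 T / alpha^2] turns the regret [DX GX / sqrt N] of the inner
    loop into at most [alpha / sqrt T]. *)
Lemma play_guarantee t : (1 <= t <= T)%N ->
  X (s t) /\
  dot (w t) (ell (s t) (y t)) <= support_fun K (w t) + (Num.sqrt T%:R)^-1.
Proof.
move=> tT; have [_ ->] := play_calls tT.
have wt : eball 1 (w t).
  by apply: w_eball; case/andP: tT => -> /leqW.
have [Xs le] := inner_guarantee wt (exec_u1 exec tT) N0 (exec_adversary exec tT).
split=> //; rewrite -(ler_pM2l alpha0); apply: le_trans le _.
rewrite mulrDr lerD2l.
have sN0 : 0 < Num.sqrt N%:R :> R by rewrite sqrtr_gt0 ltr0n.
have sT0 : 0 < Num.sqrt T%:R :> R by rewrite sqrtr_gt0 ltr0n.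
rewrite ler_pdivrMr// mulrAC ler_pdivlMr//.
have DG0 : 0 <= DX * GX * Num.sqrt T%:R by apply: mulr_ge0; [exact/ltW/mulr_gt0|exact: ltW].
have aN0 : 0 <= alpha * Num.sqrt N%:R by apply: mulr_ge0; exact: ltW.
rewrite -ler_sqr ?nnegrE//.
rewrite (exprMn 2 (DX * GX)) (exprMn 2 DX) (exprMn 2 alpha) !sqr_sqrtr ?ler0n//.
have /andP[+ _] := qN; rewrite /q ler_pdivrMr ?exprn_gt0//.
by rewrite (mulrC (DX ^+ 2)) (mulrC (alpha ^+ 2)).
Qed.

Let avg_loss := T%:R^-1 *: \sum_(1 <= t < T.+1) ell (s t) (y t).

(** Summing the subgradient inequalities at [v], the left-hand side is at most the
    average regret plus the average of [- f_t (w t)], that is at most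
    [(2 G3 + 1) / sqrt T]. *)
Lemma play_support v : eball 1 v ->
  dot v avg_loss - support_fun K v <= (6 * G3 + 3) / (2 * Num.sqrt T%:R).
Proof.
move=> v1.
have sT0 : 0 < Num.sqrt T%:R :> R by rewrite sqrtr_gt0 ltr0n.
have T0R : 0 < T%:R :> R by rewrite ltr0n.
have coK : compact K := S_tilde_compact (alpha := alpha) (r := r) coS.
have K0 : K !=set0 by exact: (S_tilde_neq0 inst alpha R_tilde_ge0).
have [M KM] := compact_enorm_bounded coK.
have gG t : (1 <= t <= T)%N -> enorm (g t) <= G3.
  move=> tT; have [Xs _] := play_guarantee tT.
  apply: (subgradient_bound K0 KM _ (exec_subgradient exec tT)) => z Kz.
  exact: (G_3_ub coS ellL XRX YRY Kz Xs (exec_adversary exec tT)).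
have regret : \sum_(1 <= t < T.+1) dot (g t) (w t - v) <= 2 * G3 * Num.sqrt T%:R.
  rewrite big_add1/=.
  apply: (@ogd_regret R d (eball 1) G3 2 T (fun i => w i.+1) (fun i => g i.+1)) => //.
  - exact: eball_compact.
  - exact: convex_eball.
  - by move=> i iT; exact: (exec_update exec).
  - by move=> i iT; exact: gG.
  - apply: le_trans (enormB _ _) _; have := w_eball (isT : (1 <= 1 <= T.+1)%N).
    by move: v1; rewrite /eball/=; lra.
have : \sum_(1 <= t < T.+1) (dot v (ell (s t) (y t)) - support_fun K v)
    <= \sum_(1 <= t < T.+1) (dot (g t) (w t - v) + (Num.sqrt T%:R)^-1).
  apply: ler_sum_nat => t tT; have [_] := play_guarantee tT.
  have := exec_subgradient exec tT v.
  rewrite /outer_obj -(opprB v) dotNr; lra.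
rewrite sumrB big_split/= !sumr_const_nat subSS subn0 -dot_sumr.
have -> : \sum_(1 <= t < T.+1) ell (s t) (y t) = T%:R *: avg_loss.
  by rewrite scalerA divff ?scale1r// gt_eqF.
rewrite dotZr -(mulr_natl (support_fun K v)) -(mulr_natl (_^-1)) -mulrBr.
have sqT := sqrtr_divE T0R.
rewrite sqT in regret; move=> H.
have -> : (6 * G3 + 3) / (2 * Num.sqrt T%:R) = (3 * G3 + 3 / 2) * (Num.sqrt T%:R)^-1.
  by field; rewrite gt_eqF.
have sTV : 0 < (Num.sqrt T%:R)^-1 :> R by rewrite invr_gt0.
rewrite -(ler_pM2l T0R).
have : T%:R * (Num.sqrt T%:R)^-1 * (2 * G3 + 1)
    <= T%:R * ((3 * G3 + 3 / 2) * (Num.sqrt T%:R)^-1).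
  rewrite -mulrA ler_pM2l// (mulrC _ (2 * G3 + 1)) ler_pM2r//.
  by move: G30; generalize G3 => z z0; lra.
lra.
Qed.

Lemma play_distance :
  set_dist avg_loss (down_closure [set alpha^-1 *: z | z in S])
    <= (6 * G3 + 3) / (2 * Num.sqrt T%:R).
Proof.
have coK : compact K := S_tilde_compact (alpha := alpha) (r := r) coS.
have c0 : 0 <= (6 * G3 + 3) / (2 * Num.sqrt T%:R).
  by rewrite divr_ge0 ?mulr_ge0 ?sqrtr_ge0// addr_ge0// mulr_ge0// ltW.
have cvK := S_tilde_convex inst (alpha := alpha) (r := r).
have K0 := S_tilde_neq0 inst alpha R_tilde_ge0.
have [p Kp] := support_distance coK cvK K0 c0 play_support.
by apply: le_trans; apply: set_dist_le; exact: S_tilde_down Kp.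
Qed.

(** The factor two is the cost of rounding up: [N <= q + 1 <= 2 * q]. *)
Lemma play_total_calls : 1 <= q ->
  (\sum_(1 <= t < T.+1) calls t)%:R
    <= 2 * (GX ^+ 2 * DX ^+ 2 * T%:R ^+ 2 / alpha ^+ 2).
Proof.
move=> q1; rewrite (eq_big_nat _ _ (F2 := fun=> N)); last first.
  by move=> t tT; have [->] := play_calls tT.
rewrite sum_nat_const_nat subSS subn0 natrM.
have -> : GX ^+ 2 * DX ^+ 2 * T%:R ^+ 2 / alpha ^+ 2 = T%:R * q by rewrite /q; ring.
rewrite mulrCA ler_wpM2l ?ler0n//.
have /andP[_ Nq] := qN; apply: le_trans Nq _.
by rewrite mulr_natl mulr2n lerD2l.
Qed.

End Play.
End Rounds.

Theorem theorem6 :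
  exists C : nat,
  forall (R : realType) (n m d : nat)
    (X : set 'cV[R]_n) (Y : set 'cV[R]_m)
    (ell : {bilinear 'cV[R]_n -> 'cV[R]_m -> 'cV[R]_d}) (S : set 'cV[R]_d)
    (L : 'I_d -> 'M[R]_(n, m)) (O : 'cV[R]_m -> 'cV[R]_m)
    (alpha RX RY DX : R) (T : nat),
  blackwell_instance X Y ell S ->
  (forall x, X x -> vle 0 x) ->
  (forall y, Y y -> vle 0 y) ->
  compact S ->
  approachable X Y ell S ->
  (forall x y, vle 0 x -> vle 0 y -> vle 0 (ell x y)) ->
  is_coord_mx ell L ->
  0 < alpha <= 1 ->
  is_approx_oracle Y alpha O ->
  (forall x, X x -> enorm x <= RX) ->
  (forall y, Y y -> enorm y <= RY) ->
  (forall x x', X x -> X x' -> enorm (x - x') <= DX) ->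
  let r := R_tilde L RX RY in
  let GX := G_X L alpha RY in
  let G3 := G_3 X Y ell S alpha r in
  let N := num_inner alpha GX DX T in
  0 < GX -> 0 < DX -> 0 < G3 ->
  (1 <= T)%N ->
  forall (w : nat -> 'cV[R]_d) (u1 s : nat -> 'cV[R]_n) (y : nat -> 'cV[R]_m)
    (g : nat -> 'cV[R]_d) (calls : nat -> nat),
  execution X Y ell L O (S_tilde S alpha r) RY
    (step_outer G3 T) (step_inner GX DX N) N T w u1 s y g calls ->
  set_dist (T%:R^-1 *: \sum_(1 <= t < T.+1) ell (s t) (y t))
       (down_closure [set alpha^-1 *: z | z in S])
    <= (6 * G3 + 3) / (2 * Num.sqrt T%:R) /\
  (1 <= GX ^+ 2 * DX ^+ 2 * T%:R / alpha ^+ 2 ->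
   (\sum_(1 <= t < T.+1) calls t)%:R
     <= C%:R * (GX ^+ 2 * DX ^+ 2 * T%:R ^+ 2 / alpha ^+ 2)).
Proof.
exists 2%N => R n m d X Y ell S L O alpha RX RY DX T inst Xge0 Yge0 coS apprS.
move=> ell_ge0 ellL alpha01 OY XRX YRY XDX r GX G3 N GX0 DX0 G30 T0.
move=> w u1 s y g calls exec; split.
  exact: (play_distance inst Xge0 Yge0 coS apprS ell_ge0 ellL alpha01 OY
    XRX YRY XDX GX0 DX0 T0 G30 exec).
by move=> q1; exact: (play_total_calls alpha01 GX0 DX0 T0 exec).
Qed.
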